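(* Let $p>1$ be an integer, $\mathbf a=(a_1,\dots,a_p)\in\mathbb Z^p$, and let $\lambda,\tau$ be positive real numbers with $\lambda+a_i\tau>0$ for $i=1,\dots,p$. Let $\Delta$ be the $\Delta_p$ bundle over $\Delta_1$ given by $$\Delta=\Big\{x\in\mathbb R^{p+1}: x_i\ge0\ (i=1,\dots,p+1),\ \sum_{i=1}^px_i\le\tau,\ x_{p+1}-\sum_{i=1}^pa_ix_i\le\lambda\Big\}.$$ If $(\Delta,\mathbf b)$ is a mass linear pair, with $\langle\mathrm{Cm}(\Delta(k)),\mathbf b\rangle=\sum_{j=1}^{p+3}R_jk_j+C$ for all $k\in\mathcal C_\Delta$ ($R_j$, $C$ constants), then $\sum_{j=1}^{p+3}R_j=0$.
   Context: With $e_1,\dots,e_{p+1}$ the standard basis of $\mathbb R^{p+1}$, $\Delta$ has outward conormals $\mathbf n_i=-e_i$ ($i=1,\dots,p$), $\mathbf n_{p+1}=\sum_{i=1}^pe_i$, $\mathbf n_{p+2}=-e_{p+1}$, $\mathbf n_{p+3}=e_{p+1}-\sum_{i=1}^pa_ie_i$. For $k\in\mathbb R^{p+3}$ put $\Delta(k)=\bigcap_{j=1}^{p+3}\{x:\langle x,\mathbf n_j\rangle\le k_j\}$, with facets $F_j(k)$ contained in $\langle x,\mathbf n_j\rangle=k_j$; thus $\Delta=\Delta(k)$ for $k_1=\dots=k_p=k_{p+2}=0$, $k_{p+1}=\tau$, $k_{p+3}=\lambda$. The chamber $\mathcal C_\Delta$ is the set of $k\in\mathbb R^{p+3}$ such that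 $\Delta(k)$ is analogous to $\Delta$: for every $J\subset\{1,\dots,p+3\}$ the facets $F_j(k)$, $j\in J$, of $\Delta(k)$ have nonempty common intersection iff the corresponding facets of $\Delta$ do. $\mathrm{Cm}(\Delta(k))$ is the center of mass of $\Delta(k)$. For $\mathbf b\in\mathbb R^{p+1}$ the pair $(\Delta,\mathbf b)$ is mass linear if constants $R_j,C\in\mathbb R$ with the displayed property exist. *)

(* Defs.v *)
From HB Require Import structures.
From mathcomp Require Import all_boot all_order all_algebra.
From mathcomp Require Import all_classical all_reals all_analysis.

Set Implicit Arguments.
Unset Strict Implicit.
Unset Printing Implicit Defensive.

Import Order.TTheory GRing.Theory Num.Theory.

Local Open Scope classical_set_scope.
Local Open Scope ring_scope.

(* Lebesgue measure on R^n. The measurable structure of MathComp-Analysis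
   lives on n.-tuple, not on row vectors: this is the product sigma-algebra,
   and the measure is the iterated product measure, transported along
   (x, t) |-> x :: t. *)

Section TupleMeasure.
Context {R : realType}.
Local Notation T := (measurableTypeR R).
Variables (n : nat) (mu : {sigma_finite_measure set (n.-tuple T) -> \bar R}).

Definition tuple_cons (xt : T * n.-tuple T) : n.+1.-tuple T :=
  [tuple of xt.1 :: xt.2].

Lemma measurable_tuple_cons : measurable_fun setT tuple_cons.
Proof. apply: (measurable_cons measurable_fst measurable_snd). Qed.

Definition tuple_measureS : set (n.+1.-tuple T) -> \bar R :=
  pushforward (lebesgue_measure \x mu)%E tuple_cons.

Let tuple_measureS0 : tuple_measureS set0 = 0%E.
Proof. by rewrite /tuple_measureS /pushforward preimage_set0 measure0. Qed.

Let tuple_measureS_ge0 A : (0 <= tuple_measureS A)%E.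
Proof. by rewrite /tuple_measureS /pushforward measure_ge0. Qed.

Let tuple_measureS_sigma_additive : semi_sigma_additive tuple_measureS.
Proof.
move=> F mF tF mUF; rewrite /tuple_measureS /pushforward preimage_bigcup.
apply: measure_semi_sigma_additive.
- by move=> k; rewrite -[X in measurable X]setTI; exact: measurable_tuple_cons.
- apply/trivIsetP => /= i j _ _ ij; rewrite -preimage_setI.
  by move/trivIsetP : tF => /(_ _ _ _ _ ij) ->//; rewrite preimage_set0.
- rewrite -preimage_bigcup -[X in measurable X]setTI.
  exact: measurable_tuple_cons.
Qed.

HB.instance Definition _ := isMeasure.Build _ _ _ tuple_measureS
  tuple_measureS0 tuple_measureS_ge0 tuple_measureS_sigma_additive.

Let tuple_measureS_sigma_finite : sigma_finite setT tuple_measureS.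
Proof.
have /sigma_finiteP[F [TF ndF Foo]] := sigma_finiteT (@lebesgue_measure R).
have /sigma_finiteP[G [TG ndG Goo]] := sigma_finiteT mu.
pose u (t : n.+1.-tuple T) := (thead t, [tuple of behead t] : n.-tuple T).
have uK : cancel u tuple_cons by move=> t; rewrite [RHS]tuple_eta.
have Ku : cancel tuple_cons u.
  by case=> x t; rewrite /u theadE; congr pair; exact/val_inj.
have mu_ : measurable_fun setT u.
  by apply/measurable_fun_pair; [exact: measurable_tnth|exact: measurable_behead].
exists (fun k => u @^-1` (F k `*` G k)).
  rewrite -preimage_bigcup (_ : \bigcup_k _ = setT) ?preimage_setT //.
  apply/seteqP; split => // -[x t] _.
  have [k _ Fkx] : (\bigcup_k F k) x by rewrite -TF.
  have [l _ Glt] : (\bigcup_k G k) t by rewrite -TG.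
  exists (maxn k l) => //; split => /=.
  - by move: x Fkx; exact/subsetPset/ndF/leq_maxl.
  - by move: t Glt; exact/subsetPset/ndG/leq_maxr.
move=> k; have [mF Fk] := Foo k; have [mG Gk] := Goo k; split.
  by rewrite -[X in measurable X]setTI; apply: mu_ => //; exact: measurableX.
rewrite /tuple_measureS /pushforward -comp_preimage.
rewrite (_ : u \o tuple_cons = id); last exact/funext.
rewrite preimage_id product_measure1E //.
by rewrite lte_mul_pinfty // ge0_fin_numE.
Qed.

HB.instance Definition _ := Measure_isSigmaFinite.Build _ _ _
  tuple_measureS tuple_measureS_sigma_finite.

End TupleMeasure.

Fixpoint lebesgue_tuple (R : realType) (n : nat) :
    {sigma_finite_measure set (n.-tuple (measurableTypeR R)) -> \bar R} :=
  match n with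
  | 0 => dirac ([tuple] : 0.-tuple (measurableTypeR R))
  | m.+1 => tuple_measureS (lebesgue_tuple R m)
  end.

Lemma lebesgue_tuple_box (R : realType) (n : nat)
    (A : 'I_n -> set (measurableTypeR R)) :
  (forall i, measurable (A i)) ->
  lebesgue_tuple R n [set t | forall i, A i (tnth t i)] =
  (\prod_(i < n) lebesgue_measure (A i))%E.
Proof.
elim: n => [|n IHn] in A * => mA.
  rewrite big_ord0 /= diracE mem_set //; by case.
rewrite big_ord_recl /= -IHn // -product_measure1E //; last first.
  rewrite (_ : [set _ | _] =
    \bigcap_(i in [set: 'I_n]) ((@tnth n _)^~ i @^-1` A (lift ord0 i))).
    apply: fin_bigcap_measurable => [|i _]; first exact: finite_finset.
     rewrite -[X in measurable X]setTI.
    exact: measurable_tnth.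
  by apply/seteqP; split => t /= h i; [move=> _|]; exact: h.
rewrite /tuple_measureS /pushforward; congr (_ _).
apply/seteqP; split => -[x t] /= h.
  split=> [|i]; first exact: (h ord0).
  by have := h (lift ord0 i); rewrite tnthS.
case: h => hx ht i; case: (unliftP ord0 i) => [j ->|-> //].
by rewrite tnthS; exact: ht.
Qed.

Section Polytopes.
Context {R : realType}.

Definition rv_of_tuple n (t : n.-tuple (measurableTypeR R)) : 'rV[R]_n :=
  \row_i tnth t i.

Definition dot n (x y : 'rV[R]_n) : R := \sum_i x 0 i * y 0 i.

Definition volume n (P : set 'rV[R]_n) : R :=
  fine (lebesgue_tuple R n (@rv_of_tuple n @^-1` P)).

Definition center_of_mass n (P : set 'rV[R]_n) : 'rV[R]_n :=
  \row_i ((\int[lebesgue_tuple R n]_(t in @rv_of_tuple n @^-1` P) tnth t i)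
          / volume P).

Variables (n N : nat) (conormal : 'I_N -> 'rV[R]_n).

Definition polytope (k : 'rV[R]_N) : set 'rV[R]_n :=
  [set x | forall j, dot x (conormal j) <= k 0 j].

(* The facet is taken as the full trace of polytope k on its supporting
   hyperplane, so it makes sense (possibly empty or of smaller dimension) for
   every k. *)
Definition facet (k : 'rV[R]_N) (j : 'I_N) : set 'rV[R]_n :=
  polytope k `&` [set x | dot x (conormal j) = k 0 j].

(* For J = set0 the common intersection is read as the whole polytope. *)
Definition facets_meet (k : 'rV[R]_N) (J : {set 'I_N}) : Prop :=
  polytope k `&` \bigcap_(j in [set` J]) facet k j !=set0.

Definition analogous (k k' : 'rV[R]_N) : Prop :=
  forall J : {set 'I_N}, facets_meet k J <-> facets_meet k' J.

Definition chamber (k0 : 'rV[R]_N) : set 'rV[R]_N := [set k | analogous k k0].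

End Polytopes.

(* Coordinates are shifted by one: x_i (i = 1..p) is x 0 (lshift 1 i') with
   i' : 'I_p, and x_(p+1) is x 0 (rshift p ord0). Similarly, the p + 3
   conormals are indexed by lshift 3 i' (n_1, ..., n_p) and by rshift p l with
   l = 0, 1, 2 (n_(p+1), n_(p+2), n_(p+3)). *)
Section Bundle.
Context {R : realType}.
Variables (p : nat) (a : 'I_p -> int).

Definition std_basis n (i : 'I_n) : 'rV[R]_n := delta_mx 0 i.

Definition last_coord : 'I_(p + 1) := rshift p ord0.

Definition bundle_conormal (j : 'I_(p + 3)) : 'rV[R]_(p + 1) :=
  match fintype.split j with
  | inl i => - std_basis (lshift 1 i)
  | inr l =>
      match val l with
      | 0%N => \sum_(i < p) std_basis (lshift 1 i)
      | 1%N => - std_basis last_coord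
      | _ => std_basis last_coord
             - \sum_(i < p) (a i)%:~R *: std_basis (lshift 1 i)
      end
  end.

Definition bundle (tau lambda : R) : set 'rV[R]_(p + 1) :=
  [set x | [/\ forall i, 0 <= x 0 i,
               \sum_(i < p) x 0 (lshift 1 i) <= tau
             & x 0 last_coord - \sum_(i < p) (a i)%:~R * x 0 (lshift 1 i)
                 <= lambda]].

Definition bundle_support (tau lambda : R) : 'rV[R]_(p + 3) :=
  \row_j match fintype.split j with
         | inl _ => 0
         | inr l => match val l with 0%N => tau | 1%N => 0 | _ => lambda end
         end.

Lemma bundleE (tau lambda : R) :
  bundle tau lambda = polytope bundle_conormal (bundle_support tau lambda).
Proof.
have dotN n (x y : 'rV[R]_n) : dot x (- y) = - dot x y.
  by rewrite /dot -sumrN; apply: eq_bigr => i _; rewrite mxE mulrN.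
have dotD n (x y z : 'rV[R]_n) : dot x (y + z) = dot x y + dot x z.
  by rewrite /dot -big_split; apply: eq_bigr => i _; rewrite mxE mulrDr.
have dotZ n c (x y : 'rV[R]_n) : dot x (c *: y) = c * dot x y.
  by rewrite /dot mulr_sumr; apply: eq_bigr => i _; rewrite mxE mulrCA.
have dote n (x : 'rV[R]_n) i : dot x (std_basis i) = x 0 i.
  rewrite /dot (bigD1 i) //= big1 => [|j ji]; rewrite !mxE /=.
    by rewrite eqxx mulr1 addr0.
  by rewrite (negbTE ji) mulr0.
have dot_sum n (x : 'rV[R]_n) m (y : 'I_m -> 'rV[R]_n) :
    dot x (\sum_i y i) = \sum_i dot x (y i).
  rewrite (big_morph (dot x) (dotD n x) (_ : dot x 0 = 0)) //.
  by rewrite /dot big1 // => i _; rewrite mxE mulr0.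
have nl i x : dot x (bundle_conormal (lshift 3 i)) = - x 0 (lshift 1 i).
  by rewrite /bundle_conormal (unsplitK (inl i : 'I_p + 'I_3)) dotN dote.
have nr (l : 'I_3) x : dot x (bundle_conormal (rshift p l)) =
    match val l with
    | 0%N => \sum_(i < p) x 0 (lshift 1 i)
    | 1%N => - x 0 last_coord
    | _ => x 0 last_coord - \sum_(i < p) (a i)%:~R * x 0 (lshift 1 i)
    end.
  rewrite /bundle_conormal (unsplitK (inr l : 'I_p + 'I_3)).
  case: (val l) => [|[|m]]; last 1 first.
  - rewrite dotD dotN dote dot_sum; congr (_ - _).
    by apply: eq_bigr => i _; rewrite dotZ dote.
  - by rewrite dot_sum; apply: eq_bigr => i _; rewrite dote.
  - by rewrite dotN dote.
have kl i : bundle_support tau lambda 0 (lshift 3 i) = 0.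
  by rewrite mxE (unsplitK (inl i : 'I_p + 'I_3)).
have kr (l : 'I_3) : bundle_support tau lambda 0 (rshift p l) =
    match val l with 0%N => tau | 1%N => 0 | _ => lambda end.
  by rewrite mxE (unsplitK (inr l : 'I_p + 'I_3)).
apply/seteqP; split => x.
  move=> [x0 xtau xlambda] j; rewrite -(splitK j); case: (fintype.split j) => [i|l].
    by rewrite /= nl kl oppr_le0.
  rewrite /= nr kr; case: l => -[|[|[]]] //= _.
  by rewrite oppr_le0.
move=> h; split.
- move=> i; rewrite -(splitK i); case: (fintype.split i) => [j|j] /=.
    by have := h (lshift 3 j); rewrite nl kl oppr_le0.
  have := h (rshift p (Ordinal (isT : (1 < 3)%N))).
  rewrite nr kr /= oppr_le0.
  by rewrite /last_coord (ord1 j).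
- by have := h (rshift p ord0); rewrite nr kr.
- by have := h (rshift p ord_max); rewrite nr kr.
Qed.

End Bundle.

(* Main.v *)
Require Import Defs.
From mathcomp Require Import all_boot all_order all_algebra.
From mathcomp Require Import all_classical all_reals all_analysis.
From mathcomp Require Import measurable_realfun ring lra.
Import Order.TTheory GRing.Theory Num.Theory.
Import numFieldNormedType.Exports.
Local Open Scope classical_set_scope.
Local Open Scope ring_scope.

(* The chamber contains the supports of all translates, by (c, d), of all
   bundles with parameters tau, lambda satisfying the positivity conditions.
   Integrating out one coordinate at a time gives the center of mass of these
   polytopes in closed form. The dependence on the translation shows that
   b = \sum_j R_j n_j. For fixed tau, after multiplication by the volume, mass
   linearity becomes an identity between quadratic polynomials in lambda: the
   coefficient of lambda ^ 2 gives R_(p+2) + R_(p+3) = 0, and the coefficient of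
   lambda, for two values of tau, gives R_1 + ... + R_(p+1) = 0. *)

(** * Beta integrals of polynomials in one variable *)

Lemma integral_deriv_poly (R : realType) (p : {poly R}) (x y : R) : x <= y ->
  (\int[lebesgue_measure]_(z in `[x, y]) (p^`()).[z]%:E = (p.[y] - p.[x])%:E)%E.
Proof.
rewrite le_eqVlt => /predU1P[<-|xy]; first by rewrite set_itv1 integral_set1 subrr.
rewrite (continuous_FTC2 (F := horner p)) //.
- by apply: continuous_subspaceT => z; exact: continuous_horner.
- split => [z _||]; first exact: derivable_horner.
  + by apply: cvg_at_right_filter; exact: continuous_horner.
  + by apply: cvg_at_left_filter; exact: continuous_horner.
- by move=> z _; rewrite derivE.
Qed.

(** Divided powers make the beta integral free of binomial factors: the product
    [divpow m (tau - u) * divpow j u] integrates over [0 <= u <= tau] to [divpow (m + j).+1 tau]. *)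
Definition divpow {R : realType} (m : nat) (x : R) : R := x ^+ m / m`!%:R.

Lemma divpowS (R : realType) m (x : R) : m.+1%:R * divpow m.+1 x = x * divpow m x.
Proof.
rewrite /divpow factS natrM exprS; field.
by rewrite !pnatr_eq0 -lt0n fact_gt0 //= nat1r pnatr_eq0.
Qed.

Lemma divpow0 (R : realType) (x : R) : divpow 0 x = 1.
Proof. by rewrite /divpow fact0 expr0 divr1. Qed.

Lemma divpow_gt0 (R : realType) m (x : R) : 0 < x -> 0 < divpow m x.
Proof. by move=> x0; rewrite divr_gt0 ?exprn_gt0 ?ltr0n ?fact_gt0. Qed.

(* Induction on j: integrating by parts trades (m, j + 1) for (m + 1, j). *)
Lemma beta_primitive (R : realType) (c tau : R) (m j : nat) :
  exists p : {poly R},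
    (forall x, p^`().[x] = divpow m (tau - (x - c)) * divpow j (x - c)) /\
    p.[c + tau] - p.[c] = divpow (m + j).+1 tau.
Proof.
pose E i (p : {poly R}) : {poly R} := (i`!%:R^-1)%:P * p ^+ i.
have hE i p x : (E i p).[x] = divpow i p.[x].
  by rewrite /E hornerCM horner_exp /divpow mulrC.
have dE i p : (E i.+1 p)^`() = E i p * p^`().
  rewrite /E deriv_mulC deriv_exp /= -[X in _ * X]mulr_natl -polyC_natr [LHS]mulrA -polyCM.
  rewrite factS natrM invfM mulrAC mulVf ?pnatr_eq0 // mul1r.
  by rewrite [p^`() * _]mulrC mulrA.
clearbody E.
have E0 i p x : p.[x] = 0 -> (E i.+1 p).[x] = 0.
  by move=> px; rewrite hE px /divpow expr0n /= mul0r.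
pose u : {poly R} := 'X - c%:P.
pose v : {poly R} := (tau + c)%:P - 'X.
have hu x : u.[x] = x - c by rewrite /u !hornerE.
have hv x : v.[x] = tau - (x - c) by rewrite /v !hornerE; ring.
have du : u^`() = 1 by rewrite /u derivB derivX derivC subr0.
have dv : v^`() = -1 by rewrite /v derivB derivX derivC sub0r.
elim: j m => [|j IHj] m.
  exists (- E m.+1 v); split => [x|].
    by rewrite derivN dE dv mulrN1 opprK hE hv divpow0 mulr1.
  rewrite !hornerN E0 ?hE ?hv; first by rewrite addn0 subrr !subr0 oppr0 add0r opprK.
  by ring.
have [p [dp pE]] := IHj m.+1.
exists (p - E m.+1 v * E j.+1 u); split => [x|].
  rewrite derivB derivM !dE du dv mulr1 mulrN1 mulNr opprD opprK.
  by rewrite !(hornerD, hornerN, hornerM) dp !hE hu hv addrA [_ + _ * _]addrC; ring.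
(* The boundary term vanishes at both ends: [u] is zero at [c] and [v] is zero at [c + tau]. *)
rewrite !(hornerD, hornerN, hornerM) !hE !hu !hv subrr (_ : tau - (c + tau - c) = 0); last by ring.
rewrite /divpow !expr0n /= !mul0r ?mulr0 ?mul0r !subr0.
by rewrite addnS -addSn.
Qed.

(* A triple (w, m, j) encodes the term w * (y ^ m / m`!) * (x ^ j / j`!). *)
Definition beta_sum {R : realType} (s : seq (R * nat * nat)) (x y : R) :=
  \sum_(q <- s) q.1.1 * (divpow q.1.2 y * divpow q.2 x).

Lemma integral_beta_sum (R : realType) (c tau : R) (s : seq (R * nat * nat)) :
  0 <= tau ->
  (\int[lebesgue_measure]_(x in `[c, (c + tau)%R])
      (beta_sum s (x - c)%R (tau - (x - c))%R)%:E =
   (\sum_(q <- s) q.1.1 * divpow (q.1.2 + q.2).+1 tau)%R%:E)%E.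
Proof.
move=> tau0.
have [p [dp pE]] : exists p : {poly R},
    (forall x, p^`().[x] = beta_sum s (x - c) (tau - (x - c))) /\
    p.[c + tau] - p.[c] = \sum_(q <- s) q.1.1 * divpow (q.1.2 + q.2).+1 tau.
  elim: s => [|[[w m] j] s [p [dp pE]]].
    exists 0; rewrite big_nil !horner0 subrr; split => // x.
    by rewrite /beta_sum big_nil deriv0 horner0.
  have [q [dq qE]] := beta_primitive _ c tau m j.
  exists (w%:P * q + p); split => [x|].
    by rewrite derivD deriv_mulC hornerD hornerCM dp dq /beta_sum big_cons.
  by rewrite big_cons /= -pE -qE !hornerD !hornerCM; ring.
rewrite -pE -integral_deriv_poly ?lerDl //.
by apply: eq_integral => x _; rewrite dp.
Qed.

(** * Splitting off the head coordinate of a tuple *)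

Lemma integral_tuple_cons (R : realType) (n : nat)
    (D : set (n.+1.-tuple (measurableTypeR R)))
    (f : n.+1.-tuple (measurableTypeR R) -> R) :
  measurable D -> measurable_fun setT f -> (forall t, D t -> 0 <= f t) ->
  (\int[lebesgue_tuple R n.+1]_(t in D) (f t)%:E =
   \int[lebesgue_measure]_x
     \int[lebesgue_tuple R n]_(t in [set t | D (tuple_cons (x, t))])
        (f (tuple_cons (x, t)))%:E)%E.
Proof.
(* Extending [f] by zero outside [D] gives an integrand that is nonnegative everywhere, as Tonelli
   requires, although [f] itself may change sign off [D]. *)
move=> mD mf f0; pose g : n.+1.-tuple (measurableTypeR R) -> \bar R := (EFin \o f) \_ D.
transitivity (\int[lebesgue_tuple R n.+1]_t g t)%E; first exact: integral_mkcond.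
have g0 t : (0 <= g t)%E.
  rewrite /g patchE; case: ifPn => // /set_mem Dt; rewrite lee_fin; exact: f0.
have mg : measurable_fun setT g.
  apply/(measurable_restrictT _ _).1 => //; apply/measurable_EFinP.
  exact: measurable_funTS.
have mc := @measurable_tuple_cons R n.
(* The measure on [n.+1]-tuples is this pushforward by definition. *)
transitivity (\int[pushforward (lebesgue_measure \x lebesgue_tuple R n)%E (@tuple_cons R n)]_t g t)%E; first by [].
rewrite ge0_integral_pushforward //.
rewrite preimage_setT fubini_tonelli1; last 2 first.
- exact: (measurableT_comp mg mc).
- by move=> t; exact: g0.
apply: eq_integral => x _; rewrite /fubini_F [RHS]integral_mkcond.
by apply: eq_integral => t _; rewrite /g /= !patchE.
Qed.

(** * Volume and first moments of a translated bundle *)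

Section BundleMoments.
Context {R : realType}.
Local Notation T := (measurableTypeR R).

Definition base_coord n (t : (n + 1).-tuple T) (i : 'I_n) : R :=
  tnth t (lshift 1 i).

Definition fiber_coord n (t : (n + 1).-tuple T) : R := tnth t (rshift n ord0).

(* The bundle translated by (c, d), in tuple coordinates. *)
Definition bundle_tuples n (a c : 'I_n -> R) (d tau lam : R) :
    set ((n + 1).-tuple T) :=
  [set t | [/\ forall i, 0 <= base_coord n t i - c i,
               0 <= fiber_coord n t - d,
               \sum_(i < n) (base_coord n t i - c i) <= tau
             & fiber_coord n t - d
               - \sum_(i < n) a i * (base_coord n t i - c i) <= lam]].

Lemma measurable_sublevel (n : nat) (f : n.-tuple T -> R) (r : R) :
  measurable_fun setT f -> measurable [set t | f t <= r].
Proof.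
by move=> mf; rewrite -[X in measurable X]setTI; exact: measurable_fun_le.
Qed.

Lemma measurable_base_coordB n (i : 'I_n) (r : R) :
  measurable_fun setT (fun t : (n + 1).-tuple T => base_coord n t i - r).
Proof. by apply: measurable_funB => //; exact: measurable_tnth. Qed.

Lemma measurable_fiber_coordB n (r : R) :
  measurable_fun setT (fun t : (n + 1).-tuple T => fiber_coord n t - r).
Proof. by apply: measurable_funB => //; exact: measurable_tnth. Qed.

Lemma measurable_bundle_tuples n (a c : 'I_n -> R) (d tau lam : R) :
  measurable (bundle_tuples n a c d tau lam).
Proof.
rewrite (_ : bundle_tuples n a c d tau lam =
  \bigcap_(i in [set: 'I_n]) [set t | - (base_coord n t i - c i) <= 0] `&`
  ([set t | - (fiber_coord n t - d) <= 0] `&`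
  ([set t | \sum_(i < n) (base_coord n t i - c i) <= tau] `&`
   [set t | fiber_coord n t - d
            - \sum_(i < n) a i * (base_coord n t i - c i) <= lam]))).
  apply: measurableI; last apply: measurableI; last apply: measurableI.
  - apply: fin_bigcap_measurable => [|i _]; first exact: finite_finset.
    by apply: measurable_sublevel; apply: measurable_funN; exact: measurable_base_coordB.
  - by apply: measurable_sublevel; apply: measurable_funN; exact: measurable_fiber_coordB.
  - by apply: measurable_sublevel; apply: measurable_sum => i; exact: measurable_base_coordB.
  - apply: measurable_sublevel; apply: measurable_funB; first exact: measurable_fiber_coordB.
    apply: measurable_sum => i; apply: measurable_funM => //.
    exact: measurable_base_coordB.
apply/seteqP; split => t /=.
  move=> [c0 d0 ctau clam]; split => [i _|] /=; first by rewrite oppr_le0.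
  by rewrite oppr_le0.
move=> [c0 [d0 [ctau clam]]]; split => // [i|].
  by have /= := c0 i I; rewrite oppr_le0.
by move: d0; rewrite oppr_le0.
Qed.

Lemma base_coord_cons0 n (x : T) (t : (n + 1).-tuple T) :
  base_coord n.+1 (tuple_cons (x, t)) ord0 = x.
Proof.
rewrite /base_coord.
have -> : lshift 1 (ord0 : 'I_n.+1) = ord0 :> 'I_(n.+1 + 1) by exact: val_inj.
exact: tnth0.
Qed.

Lemma base_coord_consS n (x : T) (t : (n + 1).-tuple T) (i : 'I_n) :
  base_coord n.+1 (tuple_cons (x, t)) (lift ord0 i) = base_coord n t i.
Proof.
rewrite /base_coord.
have -> : lshift 1 (lift ord0 i) = lift ord0 (lshift 1 i) :> 'I_(n.+1 + 1).
  exact: val_inj.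
exact: tnthS.
Qed.

Lemma fiber_coord_cons n (x : T) (t : (n + 1).-tuple T) :
  fiber_coord n.+1 (tuple_cons (x, t)) = fiber_coord n t.
Proof.
rewrite /fiber_coord.
have -> : rshift n.+1 ord0 = lift ord0 (rshift n ord0) :> 'I_(n.+1 + 1).
  exact: val_inj.
exact: tnthS.
Qed.

Lemma fiber_coord_cons0 (x : T) (t : 0.-tuple T) :
  fiber_coord 0 (tuple_cons (x, t)) = x.
Proof.
rewrite /fiber_coord.
have -> : rshift 0 ord0 = ord0 :> 'I_(0 + 1) by exact: val_inj.
exact: tnth0.
Qed.

(** The family of bundles is closed under slicing: fixing the first base coordinate at height [u]
    over [c ord0] shrinks the simplex to size [tau - u] and changes the constant term of the height
    to [lam + a ord0 * u]. All inductions on [n] below rest on this. *)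
Lemma bundle_tuples_cons n (a c : 'I_n.+1 -> R) (d tau lam : R)
    (x : T) (t : (n + 1).-tuple T) :
  bundle_tuples n.+1 a c d tau lam (tuple_cons (x, t)) <->
  0 <= x - c ord0 /\
  bundle_tuples n (a \o lift ord0) (c \o lift ord0) d
    (tau - (x - c ord0)) (lam + a ord0 * (x - c ord0)) t.
Proof.
rewrite /bundle_tuples /= fiber_coord_cons !big_ord_recl base_coord_cons0.
have -> : \sum_(i < n) (base_coord n.+1 (tuple_cons (x, t)) (lift ord0 i)
      - c (lift ord0 i)) = \sum_(i < n) (base_coord n t i - c (lift ord0 i)).
  by apply: eq_bigr => i _; rewrite base_coord_consS.
have -> : \sum_(i < n) a (lift ord0 i) *
      (base_coord n.+1 (tuple_cons (x, t)) (lift ord0 i) - c (lift ord0 i)) =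
    \sum_(i < n) a (lift ord0 i) * (base_coord n t i - c (lift ord0 i)).
  by apply: eq_bigr => i _; rewrite base_coord_consS.
split => [[c0 d0 ctau clam]|[x0 [c0 d0 ctau clam]]].
  split; first by have := c0 ord0; rewrite base_coord_cons0.
  split => // [i||]; first by have := c0 (lift ord0 i); rewrite base_coord_consS.
    by rewrite lerBrDl.
  by move: clam; rewrite opprD addrA addrAC lerBlDr.
split => // [i||].
- by case: (unliftP ord0 i) => [j ->|->]; rewrite ?base_coord_cons0 ?base_coord_consS.
- by rewrite -lerBrDl.
- by rewrite opprD addrA addrAC lerBlDr.
Qed.

(** The inequalities are weak because the slice at the far end of the integration interval is
    degenerate, with simplex of size 0, and the induction has to cover it. *)
Definition bundle_pos n (a : 'I_n -> R) (tau lam : R) : Prop :=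
  [/\ 0 <= tau, 0 <= lam & forall i, 0 <= lam + a i * tau].

(** The height is affine on the simplex, so its values at the vertices of a slice are convex
    combinations, with weights [x / tau] and [1 - x / tau], of values at the original vertices. The
    case [tau = 0] is treated apart, as these weights then make no sense. *)
Lemma bundle_pos_cons n (a : 'I_n.+1 -> R) (tau lam x : R) :
  bundle_pos n.+1 a tau lam -> 0 <= x <= tau ->
  bundle_pos n (a \o lift ord0) (tau - x) (lam + a ord0 * x).
Proof.
move=> [tau0 lam0 pos] /andP[x0 xtau].
have y0 : 0 <= tau - x by rewrite subr_ge0.
have [tau_eq0|tau_neq0] := eqVneq tau 0.
  have -> : x = 0 by apply/le_anti; rewrite x0 andbT -tau_eq0.
  by split => [||i /=]; rewrite ?tau_eq0 ?subr0 ?mulr0 ?addr0.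
have tau_gt0 : 0 < tau by rewrite lt_def tau_neq0.
split => // [|i /=]; rewrite -(pmulr_rge0 _ tau_gt0).
  have -> : tau * (lam + a ord0 * x) =
    x * (lam + a ord0 * tau) + (tau - x) * lam by ring.
  by rewrite addr_ge0 // mulr_ge0.
have -> : tau * (lam + a ord0 * x + a (lift ord0 i) * (tau - x)) =
    x * (lam + a ord0 * tau) + (tau - x) * (lam + a (lift ord0 i) * tau) by ring.
by rewrite addr_ge0 // mulr_ge0.
Qed.

Lemma integral_bundle_cons n (a c : 'I_n.+1 -> R) (d tau lam : R)
    (f : (n.+1 + 1).-tuple T -> R) :
  measurable_fun setT f ->
  (forall t, bundle_tuples n.+1 a c d tau lam t -> 0 <= f t) ->
  (\int[lebesgue_tuple R (n.+1 + 1)]_(t in bundle_tuples n.+1 a c d tau lam)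
     (f t)%:E =
   \int[lebesgue_measure]_(x in `[c ord0, (c ord0 + tau)%R])
     \int[lebesgue_tuple R (n + 1)]_(t in
        bundle_tuples n (a \o lift ord0) (c \o lift ord0) d
          (tau - (x - c ord0))%R (lam + a ord0 * (x - c ord0))%R)
       (f (tuple_cons (x, t)))%:E)%E.
Proof.
move=> mf f0.
(* [n.+1 + 1] computes to [(n + 1).+1], so the head of the tuple is the first base coordinate. *)
rewrite (integral_tuple_cons R (n + 1) _ f (measurable_bundle_tuples n.+1 a c d tau lam) mf f0).
rewrite [RHS]integral_mkcond; apply: eq_integral => x _; rewrite patchE.
case: ifPn => [/set_mem|/negP xN].
  rewrite /= in_itv /= => /andP[cx _]; congr (integral _ _ _).
  apply/seteqP; split => t; first by move/bundle_tuples_cons => [].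
  by move=> Dt; apply/bundle_tuples_cons; rewrite subr_ge0.
rewrite (_ : [set t | _] = set0) ?integral_set0 //.
apply/seteqP; split => t //= /bundle_tuples_cons [cx [t0 _ ttau _]].
apply: xN; apply/mem_set; rewrite /= in_itv /= -subr_ge0 cx /= addrC -lerBlDr.
by rewrite -subr_ge0 (le_trans _ ttau) // sumr_ge0.
Qed.

Lemma integral_bundle0 (a c : 'I_0 -> R) (d tau lam : R)
    (f : (0 + 1).-tuple T -> R) :
  0 <= tau -> measurable_fun setT f ->
  (forall t, bundle_tuples 0 a c d tau lam t -> 0 <= f t) ->
  (\int[lebesgue_tuple R (0 + 1)]_(t in bundle_tuples 0 a c d tau lam)
     (f t)%:E =
   \int[lebesgue_measure]_(x in `[d, (d + lam)%R])
       (f (tuple_cons (x, [tuple])))%:E)%E.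
Proof.
move=> tau0 mf f0.
rewrite (integral_tuple_cons R 0 _ f (measurable_bundle_tuples 0 a c d tau lam) mf f0).
rewrite [RHS]integral_mkcond; apply: eq_integral => x _; rewrite patchE.
have nil_eq (t : 0.-tuple T) : t = [tuple] by rewrite tuple0.
have DE (t : 0.-tuple T) : bundle_tuples 0 a c d tau lam (tuple_cons (x, t)) <->
    x \in `[d, d + lam].
  rewrite /bundle_tuples /= fiber_coord_cons0 !big_ord0 subr0 in_itv /= subr_ge0 lerBlDl.
  by split => [[_ -> _ ->]|/andP[-> ->]] //; split => // -[].
case: ifPn => [/set_mem /= xd|/negP xN].
  rewrite (_ : [set t | _] = setT); last first.
    by apply/seteqP; split => t // _; apply/DE.
  (* The measure on 0-tuples is a Dirac mass, so this inner integral is an evaluation. *)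
  transitivity (\int[lebesgue_tuple R 0]_(t in setT)
      cst (f (tuple_cons (x, [tuple])))%:E t)%E.
    by apply: eq_integral => t _; rewrite (nil_eq t).
  by rewrite integral_cst //= diracE in_setT mule1.
rewrite (_ : [set t | _] = set0) ?integral_set0 //.
by apply/seteqP; split => t //= /DE xd; apply: xN; apply/mem_set.
Qed.

(** The induction step shared by the volume and both moments: once the slice integrals are written
    as a [beta_sum] in [u] and [tau - u], the last integration is done term by term. *)
Lemma bundle_integral_step n (a c : 'I_n.+1 -> R) (d tau lam : R)
    (f : (n.+1 + 1).-tuple T -> R) (s : seq (R * nat * nat)) :
  bundle_pos n.+1 a tau lam ->
  measurable_fun setT f ->
  (forall t, bundle_tuples n.+1 a c d tau lam t -> 0 <= f t) ->
  (forall x : R, let u := x - c ord0 in 0 <= u ->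
    let tau' := tau - u in let lam' := lam + a ord0 * u in
    bundle_pos n (a \o lift ord0) tau' lam' ->
    (\int[lebesgue_tuple R (n + 1)]_(t in
        bundle_tuples n (a \o lift ord0) (c \o lift ord0) d tau' lam')
       (f (tuple_cons (x, t)))%:E = (beta_sum s u tau')%:E)%E) ->
  (\int[lebesgue_tuple R (n.+1 + 1)]_(t in bundle_tuples n.+1 a c d tau lam)
     (f t)%:E =
   (\sum_(q <- s) q.1.1 * divpow (q.1.2 + q.2).+1 tau)%R%:E)%E.
Proof.
move=> pos mf f0 Ef; have [tau0 _ _] := pos.
rewrite integral_bundle_cons // -(integral_beta_sum _ (c ord0)) //.
apply: eq_integral => x; rewrite inE /= in_itv /= -subr_ge0 => /andP[x0 xtau].
apply: Ef => //; apply: bundle_pos_cons => //.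
by rewrite x0 /= lerBlDl.
Qed.

Lemma divpow1 (x : R) : divpow 1 x = x.
Proof. by rewrite /divpow expr1 divr1. Qed.

Lemma divpow2 (x : R) : divpow 2 x = x ^+ 2 / 2.
Proof. by []. Qed.

(** The right-hand side is the integral of the height [lam + \sum_i a i * u i] over the simplex of
    size [tau], where each [u i] contributes [divpow n.+1 tau]. *)
Lemma bundle_volume n (a c : 'I_n -> R) (d tau lam : R) :
  bundle_pos n a tau lam ->
  (\int[lebesgue_tuple R (n + 1)]_(t in bundle_tuples n a c d tau lam) 1 =
   (lam * divpow n tau + (\sum_i a i) * divpow n.+1 tau)%R%:E)%E.
Proof.
elim: n => [|n IHn] in a c tau lam * => pos.
  have [tau0 lam0 _] := pos.
  rewrite (integral_bundle0 _ _ _ _ _ (cst 1)) //.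
  have := integral_beta_sum R d lam [:: (1, 0, 0)] lam0.
  rewrite /beta_sum big_ord0 mul0r addr0 divpow0 mulr1.
  under eq_integral do rewrite big_seq1 /= !divpow0 !mulr1.
  by rewrite big_seq1 /= mul1r divpow1.
(* The triples expand the inductive formula for the slice, with [lam + a ord0 * u] in place of [lam]
   and [tau - u] in place of [tau]. *)
rewrite (bundle_integral_step n a c d tau lam (cst 1) [::
  (lam, n, 0); (a ord0, n, 1); (\sum_i a (lift ord0 i), n.+1, 0)]) //.
  rewrite !big_cons big_nil /= big_ord_recl !addn0 addn1; congr (_%:E); ring.
move=> x u u0 tau' lam' pos'; rewrite IHn //; congr (_%:E).
rewrite /beta_sum !big_cons big_nil /= !divpow0 divpow1 /lam'; ring.
Qed.

Lemma bundle_base_moment n (a c : 'I_n -> R) (d tau lam : R) (i : 'I_n) :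
  bundle_pos n a tau lam ->
  (\int[lebesgue_tuple R (n + 1)]_(t in bundle_tuples n a c d tau lam)
     (base_coord n t i - c i)%R%:E =
   (lam * divpow n.+1 tau + (\sum_i a i + a i) * divpow n.+2 tau)%R%:E)%E.
Proof.
elim: n => [|n IHn] in a c tau lam i * => pos; first by case: i.
have mf := measurable_base_coordB n.+1 i (c i).
have f0 t : bundle_tuples n.+1 a c d tau lam t -> 0 <= base_coord n.+1 t i - c i.
  by case.
have [j ij|i0] := unliftP ord0 i.
- rewrite (bundle_integral_step _ _ _ _ _ _ _ [:: (lam, n.+1, 0);
    (a ord0, n.+1, 1); (\sum_i a (lift ord0 i) + a i, n.+2, 0)] pos mf f0).
    rewrite !big_cons big_nil /= big_ord_recl !addn0 addn1; congr (_%:E); ring.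
  move=> x u u0 tau' lam' pos'.
  rewrite (eq_integral (fun t => (base_coord n t j - (c \o lift ord0) j)%:E));
    last by move=> t _; rewrite ij base_coord_consS.
  rewrite IHn //; congr (_%:E).
  rewrite /beta_sum !big_cons big_nil /= !divpow0 divpow1 /lam' ij; ring.
(* On a slice the first coordinate is the constant [u], so the moment is [u] times the volume. The
   factor 2 comes from [u * u = 2 * divpow 2 u]. *)
- rewrite (bundle_integral_step _ _ _ _ _ _ _ [:: (lam, n, 1);
    (2 * a ord0, n, 2); (\sum_i a (lift ord0 i), n.+1, 1)] pos mf f0).
    rewrite !big_cons big_nil /= big_ord_recl !addn1 addn2 i0; congr (_%:E); ring.
  move=> x u u0 tau' lam' pos'.
  rewrite (eq_integral (fun t => u%:E * cst 1 t)%E);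
    last by move=> t _; rewrite i0 base_coord_cons0 mule1.
  rewrite ge0_integralZl //; last exact: measurable_bundle_tuples.
  rewrite bundle_volume // -EFinM; congr (_%:E).
  rewrite /beta_sum !big_cons big_nil /= divpow1 divpow2 /lam'; by field.
Qed.

(** The right-hand side is the integral of half the squared height over the simplex. There
    [u i ^+ 2] contributes twice as much as [u i * u j] with distinct indices, whence the extra
    [\sum_i a i ^+ 2]. *)
Lemma bundle_fiber_moment n (a c : 'I_n -> R) (d tau lam : R) :
  bundle_pos n a tau lam ->
  (\int[lebesgue_tuple R (n + 1)]_(t in bundle_tuples n a c d tau lam)
     (fiber_coord n t - d)%R%:E =
   ((lam ^+ 2 * divpow n tau + 2 * lam * (\sum_i a i) * divpow n.+1 tau +
     ((\sum_i a i) ^+ 2 + \sum_i a i ^+ 2) * divpow n.+2 tau) / 2)%R%:E)%E.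
Proof.
elim: n => [|n IHn] in a c tau lam * => pos.
  have [tau0 lam0 _] := pos.
  rewrite integral_bundle0 //; last by move=> t [].
    have := integral_beta_sum R d lam [:: (1, 0, 1)] lam0.
    rewrite /beta_sum !big_ord0.
    under eq_integral do rewrite big_seq1 /= divpow0 divpow1 !mul1r.
    under [X in _ -> X = _]eq_integral do rewrite fiber_coord_cons0.
    move=> ->; rewrite big_seq1 /= add0n !divpow2 divpow0; congr (_%:E); by field.
  exact: measurable_fiber_coordB.
have f0 t : bundle_tuples n.+1 a c d tau lam t -> 0 <= fiber_coord n.+1 t - d.
  by case.
set A := \sum_i a (lift ord0 i); set Q := \sum_i a (lift ord0 i) ^+ 2.
rewrite (bundle_integral_step _ _ _ _ _ _ _ [:: (lam ^+ 2 / 2, n, 0);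
    (lam * a ord0, n, 1); (a ord0 ^+ 2, n, 2); (lam * A, n.+1, 0);
    (a ord0 * A, n.+1, 1); ((A ^+ 2 + Q) / 2, n.+2, 0)]
    pos (measurable_fiber_coordB n.+1 d) f0).
  rewrite !big_cons big_nil /= !big_ord_recl -/A -/Q !addn0 !addn1 addn2.
  congr (_%:E); by field.
move=> x u u0 tau' lam' pos'.
rewrite (eq_integral (fun t => (fiber_coord n t - d)%:E));
  last by move=> t _; rewrite fiber_coord_cons.
rewrite IHn //; congr (_%:E).
rewrite /beta_sum !big_cons big_nil /= divpow0 divpow1 divpow2 /lam' -/A -/Q.
by field.
Qed.

End BundleMoments.

(** * Slacks, facets and the chamber *)

Section BundlePolytopes.
Context {R : realType}.
Local Notation T := (measurableTypeR R).

Lemma dotE n (x y : 'rV[R]_n) : dot x y = (y *m x^T) 0 0.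
Proof. by rewrite mxE; apply: eq_bigr => i _; rewrite mxE mulrC. Qed.

Lemma dot_std_basis n (x : 'rV[R]_n) i : (std_basis i *m x^T) 0 0 = x 0 i.
Proof. by rewrite -rowE !mxE. Qed.

Variables (p : nat) (a : 'I_p -> int).
Local Notation aR := (fun i : 'I_p => (a i)%:~R : R).

Lemma dot_bundle_conormal_base (x : 'rV[R]_(p + 1)) (i : 'I_p) :
  dot x (bundle_conormal a (lshift 3 i)) = - x 0 (lshift 1 i).
Proof.
rewrite /bundle_conormal (unsplitK (inl i : 'I_p + 'I_3)) dotE mulNmx.
by rewrite -dot_std_basis [LHS]mxE.
Qed.

Lemma dot_bundle_conormal (x : 'rV[R]_(p + 1)) (l : 'I_3) :
  dot x (bundle_conormal a (rshift p l)) =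
  match val l with
  | 0%N => \sum_(i < p) x 0 (lshift 1 i)
  | 1%N => - x 0 (last_coord p)
  | _ => x 0 (last_coord p) - \sum_(i < p) (a i)%:~R * x 0 (lshift 1 i)
  end.
Proof.
rewrite /bundle_conormal (unsplitK (inr l : 'I_p + 'I_3)) dotE.
case: (val l) => [|[|m]].
- by rewrite mulmx_suml summxE; apply: eq_bigr => i _; rewrite dot_std_basis.
- by rewrite mulNmx -dot_std_basis [LHS]mxE.
- rewrite mulmxBl mulmx_suml [LHS]mxE dot_std_basis [X in _ + X]mxE summxE.
  congr (_ - _).
  by apply: eq_bigr => i _; rewrite -scalemxAl [LHS]mxE dot_std_basis.
Qed.

(* Support numbers of the bundle translated by (c, d). *)
Definition shifted_support (c : 'I_p -> R) (d tau lam : R) : 'rV[R]_(p + 3) :=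
  \row_j match fintype.split j with
         | inl i => - c i
         | inr l => match val l with
                    | 0%N => tau + \sum_i c i
                    | 1%N => - d
                    | _ => lam + d - \sum_i aR i * c i
                    end
         end.

Lemma shifted_support_base (c : 'I_p -> R) (d tau lam : R) (i : 'I_p) :
  shifted_support c d tau lam 0 (lshift 3 i) = - c i.
Proof. by rewrite mxE (unsplitK (inl i : 'I_p + 'I_3)). Qed.

Lemma shifted_supportE (c : 'I_p -> R) (d tau lam : R) (l : 'I_3) :
  shifted_support c d tau lam 0 (rshift p l) =
  match val l with
  | 0%N => tau + \sum_i c i
  | 1%N => - d
  | _ => lam + d - \sum_i aR i * c i
  end.
Proof. by rewrite mxE (unsplitK (inr l : 'I_p + 'I_3)). Qed.

Lemma shifted_support0 (tau lam : R) :
  shifted_support (fun=> 0) 0 tau lam = bundle_support p tau lam.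
Proof.
apply/rowP => j; rewrite !mxE; case: (fintype.split j) => [i|l].
  by rewrite oppr0.
have -> : \sum_i aR i * 0 = 0 by apply: big1 => i _; rewrite mulr0.
by rewrite big1_eq; case: (val l) => [|[|m]]; rewrite ?oppr0 ?subr0 ?addr0.
Qed.

Definition slack (k : 'rV[R]_(p + 3)) (x : 'rV[R]_(p + 1)) (j : 'I_(p + 3)) : R :=
  k 0 j - dot x (bundle_conormal a j).

Lemma slack_base (c : 'I_p -> R) (d tau lam : R) x (i : 'I_p) :
  slack (shifted_support c d tau lam) x (lshift 3 i) = x 0 (lshift 1 i) - c i.
Proof.
by rewrite /slack shifted_support_base dot_bundle_conormal_base opprK addrC.
Qed.

Lemma slackE (c : 'I_p -> R) (d tau lam : R) x (l : 'I_3) :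
  slack (shifted_support c d tau lam) x (rshift p l) =
  match val l with
  | 0%N => tau - \sum_i (x 0 (lshift 1 i) - c i)
  | 1%N => x 0 (last_coord p) - d
  | _ => lam - (x 0 (last_coord p) - d
                - \sum_i aR i * (x 0 (lshift 1 i) - c i))
  end.
Proof.
rewrite /slack shifted_supportE dot_bundle_conormal.
case: (val l) => [|[|m]].
- by rewrite sumrB; ring.
- by rewrite opprK addrC.
- under [in RHS]eq_bigr do rewrite mulrBr.
  by rewrite sumrB; ring.
Qed.

Lemma polytope_slack (k : 'rV[R]_(p + 3)) x :
  polytope (bundle_conormal a) k x <-> forall j, 0 <= slack k x j.
Proof. by split => h j; have := h j; rewrite subr_ge0. Qed.

Lemma preimage_polytope (c : 'I_p -> R) (d tau lam : R) :
  @rv_of_tuple R (p + 1) @^-1`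
    polytope (bundle_conormal a) (shifted_support c d tau lam) =
  bundle_tuples p aR c d tau lam.
Proof.
apply/seteqP; split => t /=.
  move/polytope_slack => h; split.
  - by move=> i; have := h (lshift 3 i); rewrite slack_base mxE.
  - by have := h (rshift p (Ordinal (isT : (1 < 3)%N))); rewrite slackE /= mxE.
  - have := h (rshift p ord0); rewrite slackE /= subr_ge0.
    by under eq_bigr do rewrite mxE.
  - have := h (rshift p ord_max); rewrite slackE /= subr_ge0 mxE.
    by under eq_bigr do rewrite mxE.
move=> [c0 d0 ctau clam]; apply/polytope_slack => j.
rewrite -(splitK j); case: (fintype.split j) => [i|l] /=.
  by rewrite slack_base mxE; exact: c0.
rewrite slackE; case: l => -[|[|[]]] //= _; rewrite ?subr_ge0 ?mxE //.
- by under eq_bigr do rewrite mxE.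
- by rewrite -subr_ge0.
- by under eq_bigr do rewrite mxE.
Qed.

(* A map from one polytope to the other that rescales each slack by a positive
   factor preserves incidences between facets. *)
Lemma facets_meet_slack (k k' : 'rV[R]_(p + 3)) (J : {set 'I_(p + 3)}) :
  (forall x, polytope (bundle_conormal a) k x -> exists x', forall j,
     exists2 f, 0 < f & slack k' x' j = f * slack k x j) ->
  facets_meet (bundle_conormal a) k J -> facets_meet (bundle_conormal a) k' J.
Proof.
move=> kk' [x [kx Jx]]; have [x' x'E] := kk' x kx.
have k'x' : polytope (bundle_conormal a) k' x'.
  apply/polytope_slack => j; have [f f0 ->] := x'E j.
  by apply: mulr_ge0; [exact: ltW|move/polytope_slack: kx; apply].
exists x'; split => // j Jj; split => //=.
have [_ /= xj] := Jx j Jj; have [f f0] := x'E j.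
by rewrite /slack xj subrr mulr0 => /eqP; rewrite subr_eq0 => /eqP.
Qed.

(** The height at [u] is a weighted mean of its values [lam] and [lam + a i * tau] at the vertices,
    which are all positive. *)
Lemma bundle_height_gt0 (tau lam : R) (u : 'I_p -> R) :
  0 < tau -> 0 < lam -> (forall i, 0 < lam + aR i * tau) ->
  (forall i, 0 <= u i) -> \sum_i u i <= tau -> 0 < lam + \sum_i aR i * u i.
Proof.
move=> tau0 lam0 pos u0 utau; rewrite -(pmulr_rgt0 _ tau0).
have -> : tau * (lam + \sum_i aR i * u i) =
    (tau - \sum_i u i) * lam + \sum_i u i * (lam + aR i * tau).
  have -> : \sum_i u i * (lam + aR i * tau) =
      \sum_i (lam * u i + tau * (aR i * u i)) by apply: eq_bigr => i _; ring.
  by rewrite big_split /= -!mulr_sumr; ring.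
have sum0 : 0 <= \sum_i u i * (lam + aR i * tau).
  by apply: sumr_ge0 => i _; rewrite mulr_ge0 // ltW.
(* If [\sum_i u i < tau], the weight of [lam] is positive. Otherwise a zero sum would force every
   [u i], and hence [tau], to be 0. *)
move: utau; rewrite le_eqVlt => /predU1P[utau|utau]; last first.
  by rewrite ltr_pwDl // mulr_gt0 // subr_gt0.
rewrite utau subrr mul0r add0r lt_def sum0 andbT; apply/negP.
rewrite psumr_eq0 => [/allP u_eq0|i _]; last by rewrite mulr_ge0 // ltW.
move: tau0; rewrite -utau big1 ?ltxx // => i _.
have := u_eq0 i (mem_index_enum i).
by rewrite /= mulf_eq0 (gt_eqF (pos i)) orbF => /eqP.
Qed.

Definition bundle_admissible (tau lam : R) : Prop :=
  [/\ 0 < tau, 0 < lam & forall i, 0 < lam + aR i * tau].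

(** Scaling the base by [tau' / tau] and each fiber by the ratio of the heights [H' / H] above its
    base point maps one bundle to the other and rescales every slack by a positive factor. *)
Lemma facets_meet_shifted (c c' : 'I_p -> R) (d d' tau tau' lam lam' : R)
    (J : {set 'I_(p + 3)}) :
  bundle_admissible tau lam -> bundle_admissible tau' lam' ->
  facets_meet (bundle_conormal a) (shifted_support c d tau lam) J ->
  facets_meet (bundle_conormal a) (shifted_support c' d' tau' lam') J.
Proof.
move=> [tau0 lam0 pos] [tau0' lam0' pos']; apply: facets_meet_slack => x.
move/polytope_slack => kx.
pose u i := x 0 (lshift 1 i) - c i.
have u0 i : 0 <= u i by have := kx (lshift 3 i); rewrite slack_base.
have utau : \sum_i u i <= tau.
  by have := kx (rshift p ord0); rewrite slackE subr_ge0.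
pose s := tau' / tau; have s0 : 0 < s by rewrite divr_gt0.
have su : \sum_i s * u i = s * \sum_i u i by rewrite mulr_sumr.
pose H := lam + \sum_i aR i * u i.
pose H' := lam' + \sum_i aR i * (s * u i).
have H0 : 0 < H by exact: (bundle_height_gt0 tau).
have H0' : 0 < H'.
  apply: (bundle_height_gt0 tau') => // [i|]; first by rewrite mulr_ge0 // ltW.
  by rewrite su (le_trans (ler_wpM2l (ltW s0) utau)) // divfK ?gt_eqF.
pose x' : 'rV[R]_(p + 1) :=
  row_mx (\row_i (c' i + s * u i)) (const_mx (d' + H' / H * (x 0 (last_coord p) - d))).
have x'l i : x' 0 (lshift 1 i) - c' i = s * u i.
  by rewrite /x' row_mxEl mxE addrC addKr.
have x'r : x' 0 (last_coord p) - d' = H' / H * (x 0 (last_coord p) - d).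
  by rewrite /x' row_mxEr mxE addrC addKr.
exists x' => j; rewrite -(splitK j); case: (fintype.split j) => [i|l] /=.
  by exists s => //; rewrite !slack_base.
rewrite !slackE; case: l => -[|[|[]]] //= _.
- exists s => //; under eq_bigr do rewrite x'l.
  by rewrite su mulrBr /s; congr (_ - _); rewrite divfK ?gt_eqF.
- by exists (H' / H); rewrite ?divr_gt0.
- exists (H' / H); first by rewrite divr_gt0.
  under eq_bigr do rewrite x'l.
  rewrite x'r; set h := x 0 (last_coord p) - d.
  (* The last slack is the height minus the fiber coordinate, so it too scales by [H' / H]. *)
  have shift (L S z : R) : L - (z - S) = L + S - z by ring.
  rewrite (shift lam) (shift lam') -/H -/H' [RHS]mulrBr; congr (_ - _).
  by rewrite divfK ?gt_eqF.
Qed.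

End BundlePolytopes.

(** * Center of mass of the translated bundles *)

Lemma Rintegral_mean_shift (dT : measure_display) (T : measurableType dT)
    (R : realType) (mu : {measure set T -> \bar R}) (D : set T) (f : T -> R)
    (c m v : R) :
  measurable D -> measurable_fun D (fun t => f t - c) ->
  (forall t, D t -> 0 <= f t - c) ->
  (\int[mu]_(t in D) 1 = v%:E)%E ->
  (\int[mu]_(t in D) (f t - c)%R%:E = m%:E)%E -> v != 0 ->
  (\int[mu]_(t in D) f t) / fine (mu D) = c + m / v.
Proof.
move=> mD mf f0 vE mE v0.
have muD : mu D = v%:E by rewrite -vE integral_cst // mul1e.
(* Being nonnegative, [f - c] equals its own norm, and its integral is the finite number [m].
   Integrability lets the constant [c] be split off the mean of [f]. *)
have If : mu.-integrable D (EFin \o (fun t => f t - c)).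
  apply/integrableP; split; first exact/measurable_EFinP.
  rewrite (eq_integral (fun t => (f t - c)%:E)) ?mE ?ltry // => t /set_mem Dt.
  by rewrite /= ger0_norm ?f0.
have Ic : mu.-integrable D (EFin \o cst c).
  apply/integrableP; split; first by apply/measurable_EFinP.
  by rewrite (eq_integral (cst `|c|%:E)) // integral_cst // muD -EFinM ltry.
rewrite muD /= (_ : (fun t => f t) = (fun t => (f t - c) + c)); last first.
  by apply/funext => t; rewrite subrK.
rewrite RintegralD // Rintegral_cst // muD /= /Rintegral mE /=.
by rewrite mulrDl [LHS]addrC mulfK.
Qed.

Section BundleCenterOfMass.
Context {R : realType}.
Variables (p : nat) (a : 'I_p -> int).
Local Notation aR := (fun i : 'I_p => (a i)%:~R : R).

(* Volume and first moments of the bundle, both divided by tau ^ p / p`!. *)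
Definition nvolume (tau lam : R) : R :=
  lam + (\sum_i aR i) * (tau / p.+1%:R).

Definition nbase_moment (tau lam : R) (i : 'I_p) : R :=
  tau / p.+1%:R * (lam + (\sum_i aR i + aR i) * (tau / p.+2%:R)).

Definition nfiber_moment (tau lam : R) : R :=
  (lam ^+ 2 + 2 * lam * (\sum_i aR i) * (tau / p.+1%:R) +
   ((\sum_i aR i) ^+ 2 + \sum_i aR i ^+ 2) *
     (tau / p.+1%:R * (tau / p.+2%:R))) / 2.

Lemma divpowS_div (m : nat) (x : R) :
  divpow m.+1 x = divpow m x * (x / m.+1%:R).
Proof.
apply: (@mulfI _ m.+1%:R); first by rewrite pnatr_eq0.
by rewrite divpowS; field; rewrite nat1r pnatr_eq0.
Qed.

Lemma bundle_admissible_pos (tau lam : R) :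
  bundle_admissible p a tau lam -> bundle_pos p aR tau lam.
Proof. by move=> [tau0 lam0 pos]; split => [||i]; exact: ltW. Qed.

(** The normalized volume is the height above the centroid of the simplex, the point with all
    coordinates [tau / p.+1%:R]. *)
Lemma nvolume_gt0 (tau lam : R) :
  bundle_admissible p a tau lam -> 0 < nvolume tau lam.
Proof.
move=> [tau0 lam0 pos].
have := bundle_height_gt0 p a tau lam (fun=> tau / p.+1%:R) tau0 lam0 pos.
rewrite -mulr_suml; apply => [i|]; first by rewrite divr_ge0 // ltW.
rewrite sumr_const card_ord -[X in X <= _]mulr_natr -mulrA.
apply: ler_piMr; first exact: ltW.
by rewrite mulrC ler_pdivrMr ?ltr0n // mul1r ler_nat.
Qed.

Lemma shifted_center_of_mass (c : 'I_p -> R) (d tau lam : R) :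
  bundle_admissible p a tau lam ->
  let Cm := center_of_mass
    (polytope (bundle_conormal a) (shifted_support p a c d tau lam)) in
  (forall i, Cm 0 (lshift 1 i) =
     c i + nbase_moment tau lam i / nvolume tau lam) /\
  Cm 0 (last_coord p) = d + nfiber_moment tau lam / nvolume tau lam.
Proof.
move=> adm Cm; have pos := bundle_admissible_pos _ _ adm.
have [tau0 _ _] := adm.
have e0 : divpow p tau != 0 by rewrite gt_eqF ?divpow_gt0.
have V0 : nvolume tau lam != 0 by rewrite gt_eqF ?nvolume_gt0.
have mD := measurable_bundle_tuples p aR c d tau lam.
have VE := bundle_volume p aR c d tau lam pos.
have VnE : lam * divpow p tau + (\sum_i aR i) * divpow p.+1 tau =
    divpow p tau * nvolume tau lam by rewrite divpowS_div /nvolume; ring.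
rewrite VnE in VE.
have dV0 : divpow p tau * nvolume tau lam != 0 by rewrite mulf_neq0.
have scale m : divpow p tau * m / (divpow p tau * nvolume tau lam) =
  m / nvolume tau lam by rewrite -mulf_div divff // mul1r.
split => [i|]; rewrite /Cm /center_of_mass mxE /volume preimage_polytope.
- rewrite (Rintegral_mean_shift _ _ _ _ _ _ (c i) _ _ mD _ _ VE
    (bundle_base_moment p aR c d tau lam i pos) dV0).
  + rewrite -scale; congr (_ + _ / _).
    by rewrite !divpowS_div /nbase_moment; ring.
  + by apply: measurable_funTS; exact: measurable_base_coordB.
  + by move=> t [].
- rewrite (Rintegral_mean_shift _ _ _ _ _ _ d _ _ mD _ _ VE
    (bundle_fiber_moment p aR c d tau lam pos) dV0).
  + rewrite -scale; congr (_ + _ / _).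
    by rewrite !divpowS_div /nfiber_moment; ring.
  + by apply: measurable_funTS; exact: measurable_fiber_coordB.
  + by move=> t [].
Qed.

End BundleCenterOfMass.

(** * Mass linearity as a polynomial identity *)

Theorem proposition18 (R : realType) (p : nat) (a : 'I_p -> int)
    (lambda tau : R) (b : 'rV[R]_(p + 1)) (r : 'rV[R]_(p + 3)) (C : R)
    (hp : (1 < p)%N) (hlambda : 0 < lambda) (htau : 0 < tau)
    (ha : forall i : 'I_p, 0 < lambda + (a i)%:~R * tau)
    (hml : forall k : 'rV[R]_(p + 3),
      chamber (bundle_conormal a) (bundle_support p tau lambda) k ->
      dot (center_of_mass (polytope (bundle_conormal a) k)) b =
        \sum_j r 0 j * k 0 j + C) :
  \sum_j r 0 j = 0.
Proof.
have adm0 : bundle_admissible p a tau lambda by [].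
pose A : R := \sum_i (a i)%:~R.
pose B := \sum_(i < p) b 0 (lshift 1 i).
pose S := \sum_(i < p) r 0 (lshift 3 i).
pose bl := b 0 (last_coord p).
pose r0 := r 0 (rshift p (@Ordinal 3 0 isT)).
pose r1 := r 0 (rshift p (@Ordinal 3 1 isT)).
pose r2 := r 0 (rshift p (@Ordinal 3 2 isT)).
have sum3 (F : 'I_3 -> R) : \sum_l F l =
    F (@Ordinal 3 0 isT) + F (@Ordinal 3 1 isT) + F (@Ordinal 3 2 isT).
  rewrite !big_ord_recl big_ord0 addr0 addrA.
  by congr (F _ + F _ + F _); apply: val_inj.
(* Translating all base coordinates by the same [c] is enough, since only the sums [B] and [S] are
   wanted. *)
have mass (c d t l : R) : bundle_admissible p a t l ->
    (\sum_(i < p) nbase_moment p a t l i * b 0 (lshift 1 i)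
     + nfiber_moment p a t l * bl) / nvolume p a t l + c * B + d * bl =
    - c * S + r0 * (t + p%:R * c) - r1 * d + r2 * (l + d - A * c) + C.
  move=> adm; have [Cb Cf] := shifted_center_of_mass p a (fun=> c) d t l adm.
  (* The reference support is the one with zero translation, so both supports come from admissible
     bundles. *)
  have chk : chamber (bundle_conormal a) (bundle_support p tau lambda)
      (shifted_support p a (fun=> c) d t l).
    by rewrite -(shifted_support0 _ a) => J; split; exact: facets_meet_shifted.
  have dotb : dot (center_of_mass (polytope (bundle_conormal a)
        (shifted_support p a (fun=> c) d t l))) b =
      (\sum_(i < p) nbase_moment p a t l i * b 0 (lshift 1 i)
       + nfiber_moment p a t l * bl) / nvolume p a t l + c * B + d * bl.
    rewrite /dot big_split_ord /= big_ord1 Cf.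
    rewrite (eq_bigr (fun i => c * b 0 (lshift 1 i) +
        nbase_moment p a t l i * b 0 (lshift 1 i) / nvolume p a t l)).
      by rewrite big_split /= -mulr_sumr -mulr_suml -/B -/bl; ring.
    by move=> i _; rewrite Cb; ring.
  rewrite -dotb hml // big_split_ord /= sum3 !shifted_supportE /=; congr (_ + _).
  rewrite (eq_bigr (fun i => - c * r 0 (lshift 3 i))); last first.
    by move=> i _; rewrite shifted_support_base mulrC.
  rewrite -mulr_sumr -mulr_suml sumr_const card_ord -mulr_natl -/A -/r0 -/r1 -/r2.
  by rewrite /S; ring.
(* The sizes [t = 1] and [t = 2] are used below. [N] exceeds every [|a i * t|] with [t <= 2], so
   [N], [N + 1] and [N + 2] are admissible values of [lam] for both. *)
have [N N_gt0 admN] : exists2 N : R, 0 < N & forall t x,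
    0 < t -> t <= 2 -> N <= x -> bundle_admissible p a t x.
  exists (1 + 2 * \sum_i `|(a i)%:~R : R|).
    by rewrite ltr_pwDl // mulr_ge0 // sumr_ge0.
  move=> t x t0 t2 xN.
  have ineq i : `|(a i)%:~R * t| <= 2 * \sum_i `|(a i)%:~R : R|.
    have tge0 := ltW t0; rewrite normrM (gtr0_norm t0) mulrC ler_pM //.
    by rewrite (bigD1 i) //= lerDl sumr_ge0.
  split => // [|i].
    by apply: lt_le_trans xN; rewrite ltr_pwDl // mulr_ge0 // sumr_ge0.
  have := ler_norm (- ((a i)%:~R * t)); rewrite normrN.
  by have := ineq i; move: xN; lra.
have adm t i : 0 < t -> t <= 2 -> bundle_admissible p a t (N + i%:R).
  by move=> t0 t2; apply: admN => //; rewrite lerDl.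
(* Subtract the identities for [c = 0] and [c = 1]; [bl_eq] does the same with [d]. *)
have B_eq : B = - S + r0 * p%:R - r2 * A.
  have h0 := mass 0 0 1 (N + 0%:R) (adm 1 0 ltr01 (ler1n _ 2)).
  have h1 := mass 1 0 1 (N + 0%:R) (adm 1 0 ltr01 (ler1n _ 2)).
  by lra.
have bl_eq : bl = r2 - r1.
  have h0 := mass 0 0 1 (N + 0%:R) (adm 1 0 ltr01 (ler1n _ 2)).
  have h1 := mass 0 1 1 (N + 0%:R) (adm 1 0 ltr01 (ler1n _ 2)).
  by lra.
pose q : R := p.+1%:R^-1; pose q' : R := p.+2%:R^-1.
pose K := \sum_(i < p) (A + (a i)%:~R) * b 0 (lshift 1 i).
pose W := A ^+ 2 + \sum_i ((a i)%:~R : R) ^+ 2.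
have poly_eq t l : bundle_admissible p a t l ->
    l * (t * q) * B + (t * q) * (t * q') * K
    + (l ^+ 2 + 2 * l * A * (t * q) + W * (t * q * (t * q'))) / 2 * bl =
    (r0 * t + r2 * l + C) * (l + A * (t * q)).
  move=> adm_tl; have V_neq0 := lt0r_neq0 (nvolume_gt0 p a t l adm_tl).
  have : (\sum_(i < p) nbase_moment p a t l i * b 0 (lshift 1 i)
      + nfiber_moment p a t l * bl) / nvolume p a t l = r0 * t + r2 * l + C.
    by have := mass 0 0 t l adm_tl; lra.
  move=> /(canRL (divfK V_neq0)).
  rewrite /nvolume /nfiber_moment -/A -/W => <-; congr (_ + _).
  rewrite /B /K !mulr_sumr -big_split /=; apply: eq_bigr => i _.
  by rewrite /nbase_moment -/A -/q -/q'; ring.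
have coefs t : 0 < t -> t <= 2 ->
    bl = 2 * r2 /\ t * q * (B + r2 * A) = r0 * t + C.
  move=> t0 t2.
  have e0 := poly_eq _ _ (adm t 0 t0 t2).
  have e1 := poly_eq _ _ (adm t 1 t0 t2).
  have e2 := poly_eq _ _ (adm t 2 t0 t2).
  (* The second difference of the three equations isolates the coefficient of [l ^+ 2]; after
     substitution, the first difference [e1 - e0] isolates that of [l]. *)
  have bl2 : bl = 2 * r2.
    by lra.
  split => //; rewrite bl2 in e0 e1.
  by lra.
have [bl2 k1] := coefs 1 ltr01 (ler1n _ 2).
have [_ k2] := coefs 2 (ltr0n _ 2) (lexx _).
have kq : B + r2 * A = r0 * p.+1%:R.
  (* The left side of [k2] is twice that of [k1], while [C] occurs once in each. *)
  have C0 : C = 0 by lra.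
  have : q * (B + r2 * A) = r0 by lra.
  by move=> <-; rewrite mulrAC mulVf ?mul1r // pnatr_eq0.
rewrite big_split_ord /= sum3 -/S -/r0 -/r1 -/r2.
(* Substituting [B_eq] in [kq] cancels [r2 * A] and leaves [S + r0 = 0]; [bl_eq] and [bl2] give
   [r1 + r2 = 0]. *)
by move: kq; rewrite B_eq -natr1; lra.
Qed.
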